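(* Idempotent $k$-translatable groupoids of the same order are isomorphic. That is, if $(Q,\cdot)$ and $(S,* )$ are idempotent groupoids of the same order $n$, each $k$-translatable (for the same $k$) with respect to some ordering of its elements, then $(Q,\cdot)$ and $(S,* )$ are isomorphic.
   Context: A groupoid is a set with a binary operation $\cdot$. It is idempotent if $x\cdot x=x$ for all $x$. For an integer $x$, $[x]_n$ denotes the residue of $x$ modulo $n$, represented in $\{1,\ldots,n\}$, with $0$ identified with $n$. For $1\le k<n$, a groupoid $Q$ of order $n$ is $k$-translatable with respect to an ordering $q_1,\ldots,q_n$ of its elements if in its multiplication table (rows and columns listed in this order) each row is obtained from the preceding one by cyclically shifting it $k$ places to the right, i.e. $q_i\cdot q_j=q_{i-1}\cdot q_{[j-k]_n}$ for all $j$ and all $2\le i\le n$. *)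

(* Defs.v *)
From mathcomp Require Import all_boot.
Set Implicit Arguments.
Unset Strict Implicit.
Unset Printing Implicit Defensive.

(* Positions are numbered from 0, so q i stands for q_{i+1}. The congruence
   j = j' + k (mod n) has a unique solution j' in 'I_n, which is the position
   [j - k]_n; no wrap-around is made from the last row to the first one. *)
Definition translatable_wrt (n k : nat) (Q : Type) (op : Q -> Q -> Q)
    (q : 'I_n -> Q) : Prop :=
  forall i i' j j' : 'I_n,
    i' = i.+1 :> nat -> j = j' + k %[mod n] ->
    op (q i') (q j) = op (q i) (q j').

Definition translatable (n k : nat) (Q : Type) (op : Q -> Q -> Q) : Prop :=
  exists q : 'I_n -> Q, bijective q /\ translatable_wrt k op q.

Definition isomorphic_groupoids (Q S : Type) (opQ : Q -> Q -> Q)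
    (opS : S -> S -> S) : Prop :=
  exists f : Q -> S, bijective f /\ {morph f : x y / opQ x y >-> opS x y}.

(* Main.v *)
Require Import Defs.
From mathcomp Require Import all_boot.
Set Implicit Arguments.
Unset Strict Implicit.
Unset Printing Implicit Defensive.

(** Translatability says that the whole table is the first row, shifted:
    writing positions modulo n and counting them from 0,
    [q_i q_j = q_0 q_(j - k i)]  (lemma [translatable_to_row0]).
    Idempotency [q_m q_m = q_m] then reads [q_0 q_((1 - k) m) = q_m], so the
    first row takes every value and therefore takes each of them once.
    Comparing [q_i q_j = q_0 q_(j - k i)] with [q_m = q_0 q_((1 - k) m)], the
    product [q_i q_j] is [q_m] exactly when [(1 - k) m = j - k i] modulo n, or,
    without subtraction, when [m + k i = j + k m] modulo n.  The two directions
    are [position_of_product] and [product_of_position].  This condition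
    mentions only n and k, so the correspondence between the two orderings
    preserves products. *)

Lemma shift_back (n c : nat) (j : 'I_n.+1) :
  exists j' : 'I_n.+1, j = j' + c %[mod n.+1].
Proof.
exists (Ordinal (ltn_pmod (j + c * n) (ltn0Sn n))) => /=.
by rewrite modnDml -addnA -mulnSr addnC modnMDl.
Qed.

Section Translatable.

Variables (n k : nat) (Q : Type) (op : Q -> Q -> Q) (q : 'I_n.+1 -> Q).
Hypothesis tr : translatable_wrt k op q.

Lemma translatable_to_row0 (i j j' : 'I_n.+1) :
  j = j' + k * i %[mod n.+1] -> op (q i) (q j) = op (q ord0) (q j').
Proof.
case: i => i; elim: i j => [|i IHi] j lt_i_n /= eq_j.
  rewrite muln0 addn0 !modn_small // in eq_j.
  by rewrite (val_inj eq_j); congr (op (q _) _); exact: val_inj.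
have [j1 eq_j1] := shift_back k j.
rewrite (tr (i := Ordinal (ltnW lt_i_n)) _ eq_j1) //.
apply: IHi => /=; apply/eqP.
by rewrite -(eqn_modDr k) -eq_j1 eq_j mulnSr addnA.
Qed.

Hypothesis idem : idempotent_op op.

(** Going up [i] rows from [q i] and [m] rows from [q m] leads to the same
    entry of row 0, since [m + k * i = j + k * m] says that
    [j - k * i = m - k * m]. *)
Lemma product_of_position (i j m : 'I_n.+1) :
  m + k * i = j + k * m %[mod n.+1] -> op (q i) (q j) = q m.
Proof.
move=> eq_m; have [j' eq_j] := shift_back (k * i) j.
rewrite (translatable_to_row0 eq_j) -[RHS]idem; symmetry.
apply: translatable_to_row0; apply/eqP.
by rewrite -(eqn_modDr (k * i)) eq_m -modnDml eq_j modnDml addnAC.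
Qed.

(** Going up to row 0 turns the equation between products into one between
    entries of row 0, and row 0 has no repeated entry: by idempotency it
    contains the whole diagonal. *)
Lemma position_of_product (i j m : 'I_n.+1) :
  injective q -> op (q i) (q j) = q m -> m + k * i = j + k * m %[mod n.+1].
Proof.
move=> inj_q eq_m.
(* [h a] is the column [(1 - k) a], in which row 0 has the entry [q a]. *)
have [h hE] := fin_all_exists (fun a : 'I_n.+1 => shift_back (k * a) a).
have row0_h a : op (q ord0) (q (h a)) = q a.
  by rewrite -(translatable_to_row0 (hE a)) idem.
have /injF_bij[h' _ h'K] : injective h.
  by move=> a b eq_h; apply: inj_q; rewrite -row0_h eq_h row0_h.
have [j' eq_j] := shift_back (k * i) j.
have def_j' : j' = h m.
  rewrite -[j']h'K; congr h; apply: inj_q.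
  by rewrite -row0_h h'K -eq_m (translatable_to_row0 eq_j).
by rewrite -modnDml hE -def_j' -[in RHS]modnDml eq_j !modnDml addnAC.
Qed.

End Translatable.

Theorem theorem2p12 (n k : nat) (hk : 1 <= k < n)
    (Q S : finType) (opQ : Q -> Q -> Q) (opS : S -> S -> S)
    (cardQ : #|Q| = n) (cardS : #|S| = n)
    (idemQ : idempotent_op opQ) (idemS : idempotent_op opS)
    (transQ : translatable n k opQ) (transS : translatable n k opS) :
  isomorphic_groupoids opQ opS.
Proof.
case: n => [|n] in hk cardQ cardS transQ transS *; first by rewrite andbF in hk.
have [q [[q' qK q'K] trQ]] := transQ; have [s [bij_s trS]] := transS.
exists (s \o q'); split; first by apply: bij_comp => //; exists q.
move=> x y /=; rewrite -[x in LHS]q'K -[y in LHS]q'K; symmetry.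
apply: (product_of_position trS idemS).
apply: (position_of_product trQ idemQ (can_inj qK)).
by rewrite !q'K.
Qed.
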